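(* Let $A,B,C,D$ be pairwise disjoint finite sets and let $\mathcal{N}^g_A=(\mathcal{V}_{AB},\mathcal{A}_B)$ and $\mathcal{N}^g_C=(\mathcal{V}_{CD},\mathcal{A}_D)$ be generalized multiports, $\mathcal{A}_B,\mathcal{A}_D$ affine spaces with vector space translates $\mathcal{V}_B,\mathcal{V}_D$ respectively. Let $A_1\subseteq A$, $C_1\subseteq C$, let $\mathcal{A}_{A_1C_1}$ be an affine space on $A_1\uplus C_1$ with vector space translate $\mathcal{V}_{A_1C_1}$, let $$[\mathcal{N}^g_A\oplus\mathcal{N}^g_C]\cap\mathcal{A}_{A_1C_1}=\bigl((\mathcal{V}_{AB}\oplus\mathcal{V}_{CD}),(\mathcal{A}_B\oplus\mathcal{A}_D\oplus\mathcal{A}_{A_1C_1})\bigr),$$ and let $$\mathcal{N}^g_{(A-A_1)(C-C_1)}=\bigl((\mathcal{V}_{AB}\leftrightarrow\mathcal{V}_B)\oplus(\mathcal{V}_{CD}\leftrightarrow\mathcal{V}_D),\mathcal{V}_{A_1C_1}\bigr).$$ Then the generalized multiport $[\mathcal{N}^g_A\oplus\mathcal{N}^g_C]\cap\mathcal{A}_{A_1C_1}$ is rigid iff the generalized multiports $\mathcal{N}^g_A$, $\mathcal{N}^g_C$ and $\mathcal{N}^g_{(A-A_1)(C-C_1)}$ are rigid.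
   Context: All vectors are real. A vector on a finite set $X$ is a function $X\to\mathbb{R}$; for disjoint $X,Y$ vectors on $X\uplus Y$ are written $(f_X,f_Y)$ and spaces on $X\uplus Y$ carry the subscript $XY$. $\mathcal{F}_X$ is the space of all vectors on $X$, $\mathbf{0}_X$ the zero space. An affine space on $X$ is a set $x_X+\mathcal{V}_X$ with $\mathcal{V}_X$ a vector space on $X$, its vector space translate. $\mathcal{K}_X\oplus\mathcal{K}_Y=\{(f_X,g_Y):f_X\in\mathcal{K}_X,g_Y\in\mathcal{K}_Y\}$. For a vector space $\mathcal{V}_{SP}$ on $S\uplus P$: $\mathcal{V}_{SP}\circ S=\{f_S:(f_S,f_P)\in\mathcal{V}_{SP}\text{ for some }f_P\}$, $\mathcal{V}_{SP}\times S=\{f_S:(f_S,0_P)\in\mathcal{V}_{SP}\}$, and for a vector space $\mathcal{V}_P$ on $P$ the matched composition is $\mathcal{V}_{SP}\leftrightarrow\mathcal{V}_P=\{f_S:(f_S,h_P)\in\mathcal{V}_{SP}\text{ for some }h_P\in\mathcal{V}_P\}$. A generalized multiport with port set $X$ is an ordered pair $(\mathcal{V}_{XY},\mathcal{K}_Y)$ with $X\cap Y=\emptyset$, $\mathcal{V}_{XY}$ a vector space on $X\uplus Y$ and $\mathcal{K}_Y$ a collection of vectors on $Y$. If $\mathcal{K}_Y=\mathcal{A}_Y$ is an affine space with vector space translate $\mathcal{V}_Y$, it is called rigid iff $\mathcal{V}_{XY}\circ Y+\mathcal{V}_Y=\mathcal{F}_Y$ (full sum property) and $(\mathcal{V}_{XY}\times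 Y)\cap\mathcal{V}_Y=\mathbf{0}_Y$ (zero intersection property). (For the connected multiport $X=(A-A_1)\uplus(C-C_1)$ and $Y=B\uplus D\uplus A_1\uplus C_1$; for $\mathcal{N}^g_{(A-A_1)(C-C_1)}$, $X=(A-A_1)\uplus(C-C_1)$ and $Y=A_1\uplus C_1$.) *)

(* Defs.v *)
From HB Require Import structures.
From mathcomp Require Import all_boot all_order all_algebra.
From mathcomp Require Import mathcomp_extra boolp classical_sets reals.

Set Implicit Arguments.
Unset Strict Implicit.
Unset Printing Implicit Defensive.

Import GRing.Theory.
Local Open Scope ring_scope.

(* All finite sets are subsets of one ambient finite type E, so that set
   inclusions, unions and differences make sense literally. *)

Definition vec (R : realType) (E : finType) (X : {set E}) :=
  {ffun {x : E | x \in X} -> R^o}.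

Section Vectors.
Context {R : realType} {E : finType}.
Implicit Types X Y Z S P : {set E}.

(* f on X :&: Y and 0 on Y :\: X: the restriction f_Y when Y \subset X, the
   extension by zero when X \subset Y, a mere change of type when X = Y. *)
Definition res X Y (f : vec R X) : vec R Y :=
  [ffun y => if insub (val y) is Some x then f x else 0].

Lemma res_is_linear X Y : linear (@res X Y).
Proof.
move=> a f g; apply/ffunP => y; rewrite !ffunE.
by case: insub => [x|]; rewrite ?ffunE // scaler0 addr0.
Qed.

HB.instance Definition _ X Y :=
  GRing.isLinear.Build R (vec R X) (vec R Y) *:%R (@res X Y)
    (@res_is_linear X Y).

(* The vector (f_X, g_Y) on X \uplus Y; meant for disjoint X and Y. *)
Definition pairv X Y (f : vec R X) (g : vec R Y) : vec R (X :|: Y) :=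
  res (X :|: Y) f + res (X :|: Y) g.

(* K_X (+) K_Y for arbitrary collections of vectors. *)
Definition dsum X Y (K : set (vec R X)) (L : set (vec R Y)) :
    set (vec R (X :|: Y)) :=
  [set pairv f g | f in K & g in L]%classic.

(* V_X (+) V_Y *)
Definition vdsum X Y (V : {vspace vec R X}) (W : {vspace vec R Y}) :
    {vspace vec R (X :|: Y)} :=
  (linfun (res (X :|: Y)) @: V + linfun (res (X :|: Y)) @: W)%VS.

(* V_Z \circ S *)
Definition vrestr Z S (V : {vspace vec R Z}) : {vspace vec R S} :=
  (linfun (res S) @: V)%VS.

(* V_Z \times S *)
Definition vcontr Z S (V : {vspace vec R Z}) : {vspace vec R S} :=
  (linfun (res Z) @^-1: V)%VS.

(* V_SP <-> V_P *)
Definition vmatch S P (V : {vspace vec R (S :|: P)}) (W : {vspace vec R P}) :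
    {vspace vec R S} :=
  (linfun (res S) @: (V :&: linfun (res P) @^-1: W))%VS.

(* V_X seen as a space on Z, for X and Z equal as sets but written
   differently. *)
Definition vreindex X Z (V : {vspace vec R X}) : {vspace vec R Z} :=
  (linfun (res Z) @: V)%VS.

Definition translate_of X (K : set (vec R X)) (V : {vspace vec R X}) : Prop :=
  exists x : vec R X, K = [set x + v | v in [set` V]]%classic.

(* A generalized multiport with port set X, as an ordered pair; X and Y are
   disjoint wherever it is used. *)
Definition multiport X Y : Type :=
  ({vspace vec R (X :|: Y)} * set (vec R Y))%type.

(* The vector space translate of an affine space is unique, so the existential
   only names it. *)
Definition rigid X Y (N : multiport X Y) : Prop :=
  exists VY : {vspace vec R Y},
    [/\ translate_of N.2 VY,
        (vrestr Y N.1 + VY)%VS = fullv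
      & (vcontr Y N.1 :&: VY)%VS = 0%VS].

(* [N_A (+) N_C] \cap K *)
Definition connect_multiports A B C D (A1 C1 : {set E})
    (NA : multiport A B) (NC : multiport C D) (K : set (vec R (A1 :|: C1))) :
    multiport ((A :\: A1) :|: (C :\: C1)) ((B :|: D) :|: (A1 :|: C1)) :=
  (vreindex _ (vdsum NA.1 NC.1), dsum (dsum NA.2 NC.2) K).

(* The following lemmas recover the set-builder descriptions of the above
   spaces. *)

Lemma resE X Y (f : vec R X) (x : E) (xX : x \in X) (xY : x \in Y) :
  res Y f (exist _ x xY) = f (exist _ x xX).
Proof. by rewrite ffunE /= insubT. Qed.

Lemma resE0 X Y (f : vec R X) (y : {y : E | y \in Y}) :
  val y \notin X -> res Y f y = 0.
Proof. by move=> yX; rewrite ffunE insubN. Qed.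

Lemma res_pairl X Y (f : vec R X) (g : vec R Y) :
  [disjoint X & Y] -> res X (pairv f g) = f.
Proof.
move=> dXY; apply/ffunP => -[x xX].
have xXY : x \in X :|: Y by rewrite inE xX.
rewrite (resE _ xXY) ffunE (resE _ xX) resE0 ?addr0 //=.
by rewrite (disjointFr dXY).
Qed.

Lemma res_pairr X Y (f : vec R X) (g : vec R Y) :
  [disjoint X & Y] -> res Y (pairv f g) = g.
Proof.
move=> dXY; apply/ffunP => -[y yY].
have yXY : y \in X :|: Y by rewrite inE yY orbT.
rewrite (resE _ yXY) ffunE (resE _ yY) resE0 ?add0r //=.
by rewrite (disjointFl dXY).
Qed.

Lemma pair_res X Y (h : vec R (X :|: Y)) :
  [disjoint X & Y] -> pairv (res X h) (res Y h) = h.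
Proof.
move=> dXY; apply/ffunP => -[z zXY]; rewrite ffunE.
have := zXY; rewrite inE => /orP[zX|zY].
  rewrite (resE _ zX) (resE _ zXY) resE0 ?addr0 //=.
  by rewrite (disjointFr dXY).
rewrite (resE _ zY) (resE _ zXY) resE0 ?add0r //=.
by rewrite (disjointFl dXY).
Qed.

Lemma mem_vdsum X Y (V : {vspace vec R X}) (W : {vspace vec R Y}) :
  [set` vdsum V W]%classic = dsum [set` V]%classic [set` W]%classic.
Proof.
apply/seteqP; split => [h /= /memv_addP[_ /memv_imgP[f fV ->]]|_ /= [f fV [g gW <-]]].
  by move=> [_ /memv_imgP[g gW ->] ->]; exists f => //; exists g; rewrite ?lfunE.
by rewrite /pairv -!(lfunE (res (X :|: Y))) memv_add ?memv_img.
Qed.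

Lemma mem_vrestr X Y (V : {vspace vec R (X :|: Y)}) : [disjoint X & Y] ->
  [set` vrestr Y V]%classic = [set g | exists f, pairv f g \in V]%classic.
Proof.
move=> dXY; apply/seteqP; split => [g /= /memv_imgP[h hV ->]|g /= [f fgV]].
  by exists (res X h); rewrite lfunE /= pair_res.
by apply/memv_imgP; exists (pairv f g); rewrite // lfunE /= res_pairr.
Qed.

Lemma mem_vcontr X Y (V : {vspace vec R (X :|: Y)}) :
  [set` vcontr Y V]%classic = [set g | pairv 0 g \in V]%classic.
Proof.
by apply/seteqP; split => g /=; rewrite -memv_preim lfunE /= /pairv linear0 add0r.
Qed.

Lemma mem_vmatch S P (V : {vspace vec R (S :|: P)}) (W : {vspace vec R P}) :
  [disjoint S & P] ->
  [set` vmatch V W]%classic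
    = [set f | exists2 h, h \in W & pairv f h \in V]%classic.
Proof.
move=> dSP; apply/seteqP; split => [f /= /memv_imgP[h]|f /= [h hW fhV]].
  rewrite memv_cap -memv_preim !lfunE /= => /andP[hV hW] ->.
  by exists (res P h); rewrite ?pair_res.
apply/memv_imgP; exists (pairv f h); last by rewrite lfunE /= res_pairl.
by rewrite memv_cap fhV -memv_preim lfunE /= res_pairr.
Qed.

Lemma mem_vreindex X Z (V : {vspace vec R X}) :
  [set` vreindex Z V]%classic = [set res Z f | f in [set` V]]%classic.
Proof.
apply/seteqP; split => [h /= /memv_imgP[f fV ->]|_ /= [f fV <-]].
  by exists f; rewrite ?lfunE.
by rewrite -(lfunE (res Z)) memv_img.
Qed.

Lemma translate_of_uniq X (K : set (vec R X)) (V W : {vspace vec R X}) :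
  translate_of K V -> translate_of K W -> V = W.
Proof.
have sub (U U' : {vspace vec R X}) :
    translate_of K U -> translate_of K U' -> (U <= U')%VS.
  move=> [x KU] [y KU']; apply/subvP => u uU.
  have : K (x + u) by rewrite KU; exists u.
  have : K x by rewrite KU; exists 0; rewrite /= ?mem0v ?addr0.
  rewrite KU' => -[a /= aU' ya] [b /= bU' yb].
  suff -> : u = b - a by rewrite memvB.
  by apply: (addrI x); rewrite -yb -ya addrC addrACA subrr addr0 addrC.
by move=> KV KW; apply: subv_anti; rewrite !sub.
Qed.

End Vectors.

Arguments multiport R {E} X Y.

(* Main.v *)
Require Import Defs.
From mathcomp Require Import all_boot all_order all_algebra.
From mathcomp Require Import mathcomp_extra boolp classical_sets reals.

(** Rigidity only involves the translate [W] of the affine part: a multiport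
    [(V, K)] is rigid when every vector on the internal set [Y] agrees modulo
    [W] with the restriction of some member of [V], and when the only member of
    [V] that vanishes on the ports and restricts to [W] on [Y] is zero.  This
    element-wise form ([lrigid], [rigidP]) does not depend on how the underlying
    set is written ([lrigid_vreindex]).

    The theorem then combines three facts about the form [lrigid].
    - A direct sum is rigid iff both summands are ([lrigid_dsum]), since both
      conditions split into components.
    - Elimination in stages ([lrigid_stages]): imposing [W] on [Q] and [VP] on a
      set [P] of former ports is rigid iff imposing [W] alone is rigid and
      imposing [VP] on the matched composition [V <-> W] is rigid.  Surjectivity
      is obtained by first correcting the [Q]-part and then repairing the
      [P]-part with a lifted member of [V <-> W], which leaves the [Q]-part
      unchanged modulo [W]; injectivity is obtained by first killing the port
      part and then the [Q]-part.
    - Matched composition commutes with direct sums ([vmatch_vdsum]).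
    Applied to the sum of the two multiports with [Q = B :|: D] and
    [P = A1 :|: C1], they give the equivalence. *)

Set Implicit Arguments.
Unset Strict Implicit.
Unset Printing Implicit Defensive.

(* The set operations below are those of finite sets, not of classical sets. *)
Import mathcomp.boot.fintype mathcomp.boot.finset.
Import GRing.Theory.
Local Open Scope ring_scope.

Section Rigidity.
Context {R : realType} {E : finType}.
Implicit Types X Y Z S P Q M A B C D : {set E}.

(** * Restrictions and membership in the derived spaces *)

Lemma res_id X (f : vec R X) : res X f = f.
Proof. by apply/ffunP => -[x xX]; rewrite (resE _ xX). Qed.

(** Without the inclusion the two sides can differ, since the inner restriction
    replaces the values of [f] on [Z :\: Y] by zero. *)
Lemma res_res X Y Z (f : vec R X) :
  Z \subset Y -> res Z (res Y f) = res Z f.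
Proof.
move=> /subsetP sZY; apply/ffunP => -[z zZ].
rewrite (resE _ (sZY z zZ)); have [zX|zX] := boolP (z \in X).
  by rewrite !(resE _ zX).
by rewrite !resE0.
Qed.

Lemma eq_vecU X Y (f g : vec R (X :|: Y)) :
  res X f = res X g -> res Y f = res Y g -> f = g.
Proof.
move=> eX eY; apply/ffunP => -[z zXY].
have := zXY; rewrite inE => /orP[zX|zY].
  by rewrite -(resE f zXY zX) eX (resE g zXY zX).
by rewrite -(resE f zXY zY) eY (resE g zXY zY).
Qed.

Lemma in_vdsum X Y (V : {vspace vec R X}) (W : {vspace vec R Y}) h :
  [disjoint X & Y] ->
  (h \in vdsum V W) = (res X h \in V) && (res Y h \in W).
Proof.
move=> dXY; have /seteqP[sub sup] := mem_vdsum V W; apply/idP/andP => [/sub|[]].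
  by move=> [f fV [g gW <-]]; rewrite res_pairl // res_pairr.
by move=> hV hW; apply: sup; exists (res X h) => //; exists (res Y h);
  rewrite ?pair_res.
Qed.

Lemma in_vmatch S P (V : {vspace vec R (S :|: P)}) (W : {vspace vec R P}) f :
  (f \in vmatch V W) <-> exists h, [/\ h \in V, res P h \in W & f = res S h].
Proof.
split=> [/memv_imgP[h]|[h [hV hW ->]]].
  by rewrite memv_cap -memv_preim !lfunE /= => /andP[hV hW] ->; exists h.
apply/memv_imgP; exists h; rewrite ?lfunE //.
by rewrite memv_cap hV -memv_preim lfunE.
Qed.

Lemma in_vreindex X Z (V : {vspace vec R X}) h :
  X = Z -> (h \in vreindex Z V) = (res X h \in V).
Proof.
move=> eXZ; case: Z / eXZ h => h; rewrite res_id.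
have /seteqP[sub sup] := mem_vreindex X V; apply/idP/idP => [/sub[f fV <-]|hV].
  by rewrite res_id.
by apply: sup; exists h; rewrite ?res_id.
Qed.

Lemma translate_of_vspace X (V : {vspace vec R X}) :
  translate_of [set` V]%classic V.
Proof.
exists 0; apply/seteqP; split=> [v vV|_ /= [v vV <-]]; last by rewrite add0r.
by exists v; rewrite // add0r.
Qed.

Lemma translate_of_dsum X Y (K : set (vec R X)) (L : set (vec R Y)) V W :
  translate_of K V -> translate_of L W -> translate_of (dsum K L) (vdsum V W).
Proof.
have pairD (x v : vec R X) (y w : vec R Y) :
    pairv (x + v) (y + w) = pairv x y + pairv v w.
  by rewrite /pairv !linearD addrACA.
move=> [x ->] [y ->]; exists (pairv x y); rewrite mem_vdsum.
apply/seteqP; split=> [_ [_ [v vV <-] [_ [w wW <-] <-]]|_ [_ [v vV [w wW <-]] <-]].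
  by exists (pairv v w); [exists v => //; exists w | rewrite pairD].
by exists (x + v); [exists v | exists (y + w); [exists w | rewrite pairD]].
Qed.

(** * Rigidity element by element *)

(** The set [Z] carrying [V] is left arbitrary, rather than [X :|: Y], so that
    the same space can be considered with several choices of ports [X] and of
    internal set [Y] without reindexing. *)
Definition lrigid Z X Y (V : {vspace vec R Z}) (W : {vspace vec R Y}) : Prop :=
  (forall g : vec R Y, exists2 h, h \in V & res Y h - g \in W)
  /\ (forall h, h \in V -> res X h = 0 -> res Y h \in W -> h = 0).
Arguments lrigid {Z} X {Y} V W.

(** The translate of [K] being unique, the existential in [rigid] can be opened
    at [W].  A member of [V] with zero [X]-part is the extension by zero of its
    [Y]-part, which matches the zero intersection property with injectivity. *)
Lemma rigidP X Y (V : {vspace vec R (X :|: Y)}) (K : set (vec R Y)) W :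
  [disjoint X & Y] -> translate_of K W ->
  rigid ((V, K) : multiport R X Y) <-> lrigid X V W.
Proof.
move=> dXY tKW; split=> [[W' [/= tKW' full zero]]|[full zero]].
  rewrite -{}(translate_of_uniq tKW tKW') in full zero.
  split=> [g|h hV hX hW].
    have : g \in (vrestr Y V + W)%VS by rewrite full memvf.
    case/memv_addP=> _ /memv_imgP[h hV ->] [w wW ->]; exists h => //.
    by rewrite lfunE /= opprD addrA subrr sub0r memvN.
  have hE : h = res (X :|: Y) (res Y h).
    by rewrite -{1}(pair_res h dXY) hX /pairv linear0 add0r.
  have : res Y h \in (vcontr Y V :&: W)%VS.
    by rewrite memv_cap hW andbT -memv_preim lfunE /= -hE.
  by rewrite zero memv0 => /eqP hY; rewrite hE hY linear0.
exists W; split=> //=.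
  apply: subv_anti; rewrite subvf; apply/subvP => g _.
  have [h hV hgW] := full g; apply/memv_addP.
  exists (res Y h); first by rewrite -(lfunE (res Y)) memv_img.
  exists (g - res Y h); first by rewrite -memvN opprB.
  by rewrite addrC subrK.
apply: subv_anti; rewrite sub0v andbT; apply/subvP => g.
rewrite memv_cap -memv_preim lfunE /= => /andP[gV gW]; rewrite memv0.
have gE : res (X :|: Y) g = pairv 0 g by rewrite /pairv linear0 add0r.
rewrite gE in gV.
have /(congr1 (res Y)) : pairv 0 g = 0 :> vec R (X :|: Y).
  by apply: zero; rewrite ?res_pairl ?res_pairr.
by rewrite res_pairr // linear0 => ->.
Qed.

Lemma lrigid_vreindex Z Z' X Y (V : {vspace vec R Z}) (W : {vspace vec R Y}) :
  Z = Z' -> lrigid X (vreindex Z' V) W <-> lrigid X V W.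
Proof.
move=> eZ; case: Z' / eZ.
suff -> : vreindex Z V = V by [].
by apply/vspaceP => h; rewrite in_vreindex // res_id.
Qed.

(** * Direct sums and elimination in stages *)

(** A component of one block is unaffected by the other block, so each of the
    four parts of a vector on the sum can be prescribed blockwise. *)
Lemma res_pairv_blocks A B C D (h : vec R (A :|: B)) (k : vec R (C :|: D)) :
  [disjoint A :|: B & C :|: D] ->
  [/\ res A (pairv h k) = res A h, res B (pairv h k) = res B h,
      res C (pairv h k) = res C k & res D (pairv h k) = res D k].
Proof.
move=> dABCD; split.
- by rewrite -{2}(res_pairl h k dABCD) res_res ?subsetUl.
- by rewrite -{2}(res_pairl h k dABCD) res_res ?subsetUr.
- by rewrite -{2}(res_pairr h k dABCD) res_res ?subsetUl.
- by rewrite -{2}(res_pairr h k dABCD) res_res ?subsetUr.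
Qed.

Lemma lrigid_dsum A B C D (VAB : {vspace vec R (A :|: B)})
    (VCD : {vspace vec R (C :|: D)}) (VB : {vspace vec R B})
    (VD : {vspace vec R D}) :
  [disjoint A :|: B & C :|: D] -> [disjoint B & D] ->
  lrigid (A :|: C) (vdsum VAB VCD) (vdsum VB VD)
  <-> lrigid A VAB VB /\ lrigid C VCD VD.
Proof.
move=> dABCD dBD.
split=> [[full zero]|[[fullA zeroA] [fullC zeroC]]].
  have zero2 h1 h2 : h1 \in VAB -> h2 \in VCD ->
      res A h1 = 0 -> res C h2 = 0 -> res B h1 \in VB -> res D h2 \in VD ->
      pairv h1 h2 = 0.
    move=> h1V h2V hA hC hB hD.
    have [kA kB kC kD] := res_pairv_blocks h1 h2 dABCD.
    apply: zero; first by rewrite in_vdsum // res_pairl // res_pairr // h1V.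
      by apply: eq_vecU; rewrite !res_res ?subsetUl ?subsetUr // ?kA ?kC linear0.
    by rewrite in_vdsum // !res_res ?subsetUl ?subsetUr // kB kD hB.
  split; split=> [g|h hV hX hW].
  - have [h] := full (pairv g 0).
    rewrite !in_vdsum // => /andP[hV _] /andP[hW _].
    exists (res (A :|: B) h) => //; move: hW.
    by rewrite linearB /= res_pairl // !res_res ?subsetUl ?subsetUr.
  - have k0 : pairv h (0 : vec R (C :|: D)) = 0.
      by apply: zero2; rewrite ?linear0 ?mem0v.
    by rewrite -(res_pairl h 0 dABCD) k0 linear0.
  - have [h] := full (pairv 0 g).
    rewrite !in_vdsum // => /andP[_ hV] /andP[_ hW].
    exists (res (C :|: D) h) => //; move: hW.
    by rewrite linearB /= res_pairr // !res_res ?subsetUl ?subsetUr.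
  have k0 : pairv (0 : vec R (A :|: B)) h = 0.
    by apply: zero2; rewrite ?linear0 ?mem0v.
  by rewrite -(res_pairr 0 h dABCD) k0 linear0.
split=> [g|h].
  have [h1 h1V h1W] := fullA (res B g); have [h2 h2V h2W] := fullC (res D g).
  have [_ kB _ kD] := res_pairv_blocks h1 h2 dABCD.
  exists (pairv h1 h2); first by rewrite in_vdsum // res_pairl // res_pairr // h1V.
  rewrite in_vdsum // !linearB /= !res_res ?subsetUl ?subsetUr //.
  by rewrite kB kD h1W.
rewrite !in_vdsum // => /andP[h1V h2V] hX /andP[].
rewrite !res_res ?subsetUl ?subsetUr // => h1W h2W.
have hA : res A h = 0 by rewrite -(res_res h (subsetUl A C)) hX linear0.
have hC : res C h = 0 by rewrite -(res_res h (subsetUr A C)) hX linear0.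
apply: eq_vecU; rewrite linear0.
  by apply: zeroA; rewrite ?res_res ?subsetUl ?subsetUr.
by apply: zeroC; rewrite ?res_res ?subsetUl ?subsetUr.
Qed.

(** Solving first for the [Q]-part leaves an indeterminacy that [V <-> W]
    describes: its members are exactly the traces on [M] of the members of [V]
    with [Q]-part in [W].  Hence the conditions on [P] that remain are those of
    the second stage. *)
Lemma lrigid_stages M Q S P (V : {vspace vec R (M :|: Q)})
    (W : {vspace vec R Q}) (VP : {vspace vec R P}) :
  [disjoint Q & P] -> S \subset M -> P \subset M ->
  lrigid S V (vdsum W VP) <-> lrigid M V W /\ lrigid S (vmatch V W) VP.
Proof.
move=> dQP sSM sPM.
split=> [[full zero]|[[fullQ zeroQ] [fullP zeroP]]].
  split; split=> [g|h hV hX hW].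
  - have [h hV] := full (pairv g 0).
    rewrite in_vdsum // => /andP[hW _]; exists h => //.
    by move: hW; rewrite linearB /= res_pairl // res_res ?subsetUl.
  - apply: zero => //; first by rewrite -(res_res h sSM) hX linear0.
    rewrite in_vdsum // !res_res ?subsetUl ?subsetUr // hW.
    by rewrite -(res_res h sPM) hX linear0 mem0v.
  - have [h hV] := full (pairv 0 g).
    rewrite in_vdsum // !linearB /= res_pairl // res_pairr //.
    rewrite !res_res ?subsetUl ?subsetUr // subr0 => /andP[hW hP].
    exists (res M h); last by rewrite res_res.
    by apply/in_vmatch; exists h.
  have /in_vmatch[k [kV kW hE]] := hV.
  rewrite hE !res_res // in hX hW *.
  rewrite (zero k) ?linear0 // in_vdsum //.
  by rewrite !res_res ?subsetUl ?subsetUr // kW hW.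
split=> [g|h hV hS].
  have [h1 h1V h1W] := fullQ (res Q g).
  (* The P-part is repaired inside the lifts of the matched composition, whose
     Q-part lies in W, so the first correction survives. *)
  have [_ /in_vmatch[h2 [h2V h2W ->]]] := fullP (res P g - res P h1).
  rewrite res_res // => h2P; exists (h1 + h2); first exact: memvD.
  rewrite in_vdsum // !linearB !linearD /= !res_res ?subsetUl ?subsetUr //.
  apply/andP; split; first by rewrite addrAC memvD.
  by move: h2P; rewrite opprB addrA [res P h2 + _]addrC.
rewrite in_vdsum // !res_res ?subsetUl ?subsetUr // => /andP[hW hP].
apply: zeroQ => //; apply: zeroP; rewrite ?res_res //.
by apply/in_vmatch; exists h.
Qed.

(** Both sides only ask for a lift in each block separately; the reindexing
    regroups external and internal parts so that the composition makes sense. *)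
Lemma vmatch_vdsum A B C D (VAB : {vspace vec R (A :|: B)})
    (VCD : {vspace vec R (C :|: D)}) (VB : {vspace vec R B})
    (VD : {vspace vec R D}) :
  [disjoint A :|: B & C :|: D] -> [disjoint B & D] -> [disjoint A & C] ->
  vmatch (vreindex ((A :|: C) :|: (B :|: D)) (vdsum VAB VCD)) (vdsum VB VD)
  = vdsum (vmatch VAB VB) (vmatch VCD VD).
Proof.
move=> dABCD dBD dAC; have eZ := setUACA A B C D.
apply/vspaceP => f; apply/idP/idP.
  move=> /in_vmatch[h []]; rewrite in_vreindex // !in_vdsum //.
  rewrite !res_res ?subsetUl ?subsetUr // => /andP[h1 h2] /andP[hB hD] ->.
  apply/andP; split; apply/in_vmatch.
    by exists (res (A :|: B) h); split; rewrite // !res_res ?subsetUl ?subsetUr.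
  by exists (res (C :|: D) h); split; rewrite // !res_res ?subsetUl ?subsetUr.
rewrite in_vdsum // => /andP[/in_vmatch[h1 [h1V h1W fA]] /in_vmatch[h2 [h2V h2W fC]]].
have [kA kB kC kD] := res_pairv_blocks h1 h2 dABCD.
apply/in_vmatch.
exists (res ((A :|: C) :|: (B :|: D)) (pairv h1 h2)); split.
- rewrite in_vreindex // in_vdsum // !res_res -?eZ ?subsetUl ?subsetUr //.
  by rewrite res_pairl // res_pairr // h1V.
- rewrite (res_res _ (subsetUr _ _)) in_vdsum // !res_res ?subsetUl ?subsetUr //.
  by rewrite kB kD h1W.
rewrite (res_res _ (subsetUl _ _)).
by apply: eq_vecU; rewrite !res_res ?subsetUl ?subsetUr // ?kA ?kC.
Qed.

End Rigidity.

Theorem theorem25 (R : realType) (E : finType) (A B C D A1 C1 : {set E})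
    (dAB : [disjoint A & B]) (dAC : [disjoint A & C]) (dAD : [disjoint A & D])
    (dBC : [disjoint B & C]) (dBD : [disjoint B & D]) (dCD : [disjoint C & D])
    (sA1 : A1 \subset A) (sC1 : C1 \subset C)
    (VAB : {vspace vec R (A :|: B)}) (VCD : {vspace vec R (C :|: D)})
    (KB : set (vec R B)) (VB : {vspace vec R B})
    (KD : set (vec R D)) (VD : {vspace vec R D})
    (KA1C1 : set (vec R (A1 :|: C1))) (VA1C1 : {vspace vec R (A1 :|: C1)})
    (hB : translate_of KB VB) (hD : translate_of KD VD)
    (hA1C1 : translate_of KA1C1 VA1C1) :
  let NA : multiport R A B := (VAB, KB) in
  let NC : multiport R C D := (VCD, KD) in
  let Nred : multiport R ((A :\: A1) :|: (C :\: C1)) (A1 :|: C1) :=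
    (vreindex _ (vdsum (vmatch VAB VB) (vmatch VCD VD)),
     [set` VA1C1]%classic) in
  rigid (connect_multiports NA NC KA1C1)
  <-> [/\ rigid NA, rigid NC & rigid Nred].
Proof.
move=> NA NC Nred.
set S := (A :\: A1) :|: (C :\: C1); set P := A1 :|: C1.
have dUr (X Y Z : {set E}) :
    [disjoint X & Y :|: Z] = [disjoint X & Y] && [disjoint X & Z].
  by rewrite -!setI_eq0 setIUr setU_eq0.
have dUl (X Y Z : {set E}) :
    [disjoint X :|: Y & Z] = [disjoint X & Z] && [disjoint Y & Z].
  by rewrite -!setI_eq0 setIUl setU_eq0.
have dABCD : [disjoint A :|: B & C :|: D] by rewrite dUl !dUr dAC dAD dBC dBD.
have dMQ : [disjoint A :|: C & B :|: D].
  by rewrite dUl !dUr dAB dAD [[disjoint C & B]]disjoint_sym dBC dCD.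
have sPM : P \subset A :|: C by exact: setUSS.
have sSM : S \subset A :|: C by rewrite setUSS ?subsetDl.
have dQP : [disjoint B :|: D & P] by rewrite disjoint_sym (disjointWl sPM).
have dSP : [disjoint S & P].
  rewrite dUl !dUr -!andbA; apply/and4P; split.
  - by rewrite -setI_eq0 setIDAC -setIDA setDv setI0.
  - by apply: disjointW dAC; rewrite ?subsetDl.
  - by rewrite disjoint_sym; apply: disjointW dAC; rewrite ?subsetDl.
  by rewrite -setI_eq0 setIDAC -setIDA setDv setI0.
have DUK (X Y : {set E}) : Y \subset X -> (X :\: Y) :|: Y = X.
  by move=> sYX; rewrite -[RHS](setID X Y) (setIidPr sYX) setUC.
have eM : A :|: C = S :|: P by rewrite /S /P setUACA !DUK.
have dSQP : [disjoint S & (B :|: D) :|: P].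
  by rewrite dUr dSP (disjointWl sSM).
have eZ : (A :|: B) :|: (C :|: D) = S :|: ((B :|: D) :|: P).
  by rewrite setUACA eM setUAC -setUA.
have eMQ := setUACA A B C D.
pose V := vdsum VAB VCD; pose W := vdsum VB VD.
have tW : translate_of (dsum (dsum KB KD) KA1C1) (vdsum W VA1C1).
  by apply: translate_of_dsum hA1C1; apply: translate_of_dsum.
have connE : rigid (connect_multiports NA NC KA1C1)
             <-> lrigid S V (vdsum W VA1C1).
  exact: iff_trans (rigidP _ dSQP tW) (lrigid_vreindex _ _ _ eZ).
have redE : rigid Nred
            <-> lrigid S (vdsum (vmatch VAB VB) (vmatch VCD VD)) VA1C1.
  apply: iff_trans (rigidP _ dSP (translate_of_vspace _)) _.
  exact: lrigid_vreindex.
have stagesE := lrigid_stages (vreindex _ V) W VA1C1 dQP sSM sPM.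
rewrite vmatch_vdsum // in stagesE.
have reE X Y (U : {vspace vec R Y}) := lrigid_vreindex X V U eMQ.
have sumE := lrigid_dsum VAB VCD VB VD dABCD dBD.
have rigA : rigid NA <-> lrigid A VAB VB by exact: rigidP.
have rigC : rigid NC <-> lrigid C VCD VD by exact: rigidP.
split.
  move=> /connE /reE /stagesE[/reE/sumE[/rigA rA /rigC rC] /redE rred].
  by split.
move=> [/rigA rA /rigC rC /redE rred].
by apply/connE/reE/stagesE; split=> //; apply/reE/sumE.
Qed.
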